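(* Let $r\in\mathbb N$ with $r\ge3$. The estimator $\hat p=\frac{r-2}{N-1}$ minimizes $\sup_{p\in(0,1)}\mathrm E[(\hat p-p)^2]/p^2$ among all (possibly randomized) estimators based on inverse binomial sampling.
   Context: Inverse binomial sampling: for $p\in(0,1)$, $N$ is the number of i.i.d. Bernoulli($p$) trials needed to obtain $r$ successes, so $f(n)=\Pr[N=n]=\binom{n-1}{r-1}p^r(1-p)^{n-r}$ for $n\ge r$. A (possibly randomized) estimator $\hat p$ of $p$ is specified by a family $(\Pi_n)_{n\ge r}$ of distribution functions of positive random variables, not depending on $p$; $\Pi_n$ is the distribution function of $\hat p$ conditioned on $N=n$. Thus $\mathrm E[(\hat p-p)^2]/p^2=\sum_{n=r}^\infty f(n)\int_0^\infty (y/p-1)^2\,d\Pi_n(y)\in[0,\infty]$. A non-randomized estimator $\hat p=g(N)$, with $g$ positive, is the case where each $\Pi_n$ is a point mass at $g(n)$. *)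

(* Defs.v *)
From HB Require Import structures.
From mathcomp Require Import all_boot all_order all_algebra.
From mathcomp Require Import all_classical all_reals all_analysis.

Set Implicit Arguments.
Unset Strict Implicit.
Unset Printing Implicit Defensive.

Import Order.TTheory GRing.Theory Num.Theory.
Import numFieldNormedType.Exports.

Local Open Scope classical_set_scope.
Local Open Scope ring_scope.

Definition inv_binomial_pmf (R : realType) (r : nat) (p : R) (n : nat) : R :=
  'C(n.-1, r.-1)%:R * p ^+ r * (1 - p) ^+ (n - r).

(* The distribution function of the point mass at [a]. *)
Definition step_cdf (R : realType) (a x : R) : R := (a <= x)%R%:R.

Section step_cdf_cumulative.
Context (R : realType) (a : R).

Let step_cdf_nd : nondecreasing (step_cdf a).
Proof.
move=> x y xy; rewrite /step_cdf ler_nat; case: (leP a x) => // ax.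
by rewrite (le_trans ax xy).
Qed.

Let step_cdf_rc : right_continuous (step_cdf a).
Proof.
move=> x; apply: cvg_near_cst; rewrite /step_cdf.
case: (leP a x) => ax; near=> y.
- by rewrite (le_trans ax)//; apply: ltW; near: y; exact: nbhs_right_gt.
- have -> // : (a <= y) = false.
  by apply/negbTE; rewrite -ltNge; near: y; exact: nbhs_right_lt.
Unshelve. all: by end_near. Qed.

HB.instance Definition _ :=
  isCumulative.Build R _ R (step_cdf a) step_cdf_nd step_cdf_rc.

Let step_cdf_Ny0 : step_cdf a @ -oo --> (0 : R).
Proof.
apply: cvg_near_cst; rewrite /step_cdf; near=> y.
have -> // : (a <= y) = false.
by apply/negbTE; rewrite -ltNge; near: y; apply: nbhs_ninfty_lt; exact: num_real.
Unshelve. all: by end_near. Qed.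

Let step_cdf_y1 : step_cdf a @ +oo --> (1 : R).
Proof.
apply: cvg_near_cst; rewrite /step_cdf; near=> y.
have -> // : (a <= y) by near: y; apply: nbhs_pinfty_ge; exact: num_real.
Unshelve. all: by end_near. Qed.

HB.instance Definition _ :=
  isCumulativeBounded.Build R 0 1 (step_cdf a) step_cdf_Ny0 step_cdf_y1.

End step_cdf_cumulative.

(* [Pi n] is the distribution function of the estimator conditioned on
   [N = n]; only the indices [n >= r] matter, the values of [Pi] below [r] are
   unconstrained and never used. A distribution function is that of a positive
   random variable iff it vanishes at 0, as [Pi n 0] is the probability of
   being [<= 0]. *)
Definition estimator_family (R : realType) (r : nat)
    (Pi : nat -> cumulativeBounded (0 : R) (1 : R)) : Prop :=
  forall n, (r <= n)%N -> Pi n 0 = 0.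

Definition nonrandomized (R : realType) (g : nat -> R) :
    nat -> cumulativeBounded (0 : R) (1 : R) :=
  fun n => step_cdf (g n).

(* E[(phat - p)^2] / p^2, computed by conditioning on [N]. *)
Definition normalized_mse (R : realType) (r : nat)
    (Pi : nat -> cumulativeBounded (0 : R) (1 : R)) (p : R) : \bar R :=
  (\sum_(r <= n <oo) (inv_binomial_pmf r p n)%:E *
     \int[lebesgue_stieltjes_measure (Pi n)]_(y in `[0%R, +oo[)
       ((y / p - 1) ^+ 2)%:E)%E.

Definition sup_normalized_mse (R : realType) (r : nat)
    (Pi : nat -> cumulativeBounded (0 : R) (1 : R)) : \bar R :=
  ereal_sup [set normalized_mse r Pi p | p in `]0, 1[ ].

(* Main.v *)
(** Both sides are compared with the constant [1 / (r - 1)].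

    Upper bound: since [1 / (N - 1) ^ 2 <= 1 / ((N - 1) (N - 2))], and since
    dividing the law of [N] by [(N - 1) p] or [(N - 1) (N - 2) p ^ 2] gives
    multiples of the laws for [r - 1] or [r - 2] successes, the risk of
    [(r - 2) / (N - 1)] is at most [1 / (r - 1)] for every [p].

    Lower bound: by Jensen's inequality the estimator may be taken
    non-randomized. Average the risk over [p] with the prior Beta(1/L, 1),
    that is, set [p = q ^ L] with [q] uniform on [0, 1]; only finitely many
    values of [N] are kept, so that the integrands are polynomials in [q] and
    no exchange of a series with an integral is needed. Minimizing a quadratic
    for each value of [N] bounds the average from below by a quantity tending
    to [1 / (r - 1)] as the number of values kept, and then [L], go to
    infinity. *)

From HB Require Import structures.
Require Import Defs.
From mathcomp Require Import all_boot all_order all_algebra.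
From mathcomp Require Import all_classical all_reals all_analysis.
From mathcomp Require Import measurable_realfun.
From mathcomp Require Import ring lra zify.

Import Order.TTheory GRing.Theory Num.Theory.
Import numFieldNormedType.Exports.

Local Open Scope classical_set_scope.
Local Open Scope ring_scope.

(** * Formal integration of polynomials over the unit interval, and Beta integrals *)

Section PolynomialIntegral.
Context {R : realType}.
Implicit Types p q : {poly R}.

(* The coefficient of index 0 is [p`_0 / 0 = 0]. *)
Definition poly_primitive p : {poly R} :=
  \poly_(i < (size p).+1) (p`_i.-1 / i%:R).

Definition poly_int01 p : R := (poly_primitive p).[1].

Lemma coef_poly_primitive p i : (poly_primitive p)`_i = p`_i.-1 / i%:R.
Proof.
rewrite coef_poly ltnS; case: leqP => // pi.
by rewrite [p`_i.-1]nth_default ?mul0r// -ltnS (ltn_predK pi).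
Qed.

Lemma deriv_poly_primitive p : (poly_primitive p)^`() = p.
Proof.
apply/polyP => i; rewrite coef_deriv coef_poly_primitive /= -[LHS]mulr_natr.
by rewrite divfK ?pnatr_eq0.
Qed.

Lemma poly_int01_is_linear : linear poly_int01.
Proof.
move=> a p q; rewrite /poly_int01.
have -> : a *: (poly_primitive p).[1] = (a *: poly_primitive p).[1].
  by rewrite hornerZ.
rewrite -hornerD; congr _.[1].
by apply/polyP => i; rewrite !(coefD, coefZ, coef_poly_primitive) mulrDl mulrA.
Qed.

HB.instance Definition _ :=
  GRing.isLinear.Build R {poly R} R _ poly_int01 poly_int01_is_linear.

Lemma poly_int01Xn n : poly_int01 'X^n = n.+1%:R^-1.
Proof.
rewrite /poly_int01; suff -> : poly_primitive 'X^n = n.+1%:R^-1 *: 'X^(n.+1).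
  by rewrite hornerZ hornerXn expr1n mulr1.
apply/polyP => -[|i]; rewrite coef_poly_primitive coefZ !coefXn.
  by rewrite invr0 !mulr0.
rewrite eqSS /=; case: eqVneq => [->|]; first by rewrite mul1r mulr1.
by rewrite mul0r mulr0.
Qed.

(** The primitive has derivative [p], hence is nondecreasing on the unit interval, and it vanishes
    at 0. *)
Lemma poly_int01_ge0 p :
  (forall x, 0 < x < 1 -> 0 <= p.[x]) -> 0 <= poly_int01 p.
Proof.
move=> p_ge0; have -> : 0 = (poly_primitive p).[0].
  by rewrite horner_coef0 coef_poly_primitive invr0 mulr0.
apply: (@ger0_derive1_ndecr _ (horner (poly_primitive p)) 0 1) => //.
- by move=> x; rewrite in_itv/= -derivE deriv_poly_primitive; exact: p_ge0.
- by apply: continuous_subspaceT => x; exact: continuous_horner.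
Qed.

Lemma poly_int01_le p c :
  (forall x, 0 < x < 1 -> p.[x] <= c) -> poly_int01 p <= c.
Proof.
move=> pc; have int1 : poly_int01 1 = 1.
  by rewrite -(expr0 'X) poly_int01Xn invr1.
have := @poly_int01_ge0 (c *: 1 - p).
have -> : poly_int01 (c *: 1 - p) = c - poly_int01 p.
  by rewrite linearB linearZ/= int1 /GRing.scale/= mulr1.
rewrite subr_ge0; apply => x /pc.
by rewrite !hornerE subr_ge0.
Qed.

(* After the substitution [p = q ^ L], [L * beta_int L a m] is the Beta
   integral [B(a + 1/L, m + 1)]. *)
Definition beta_int (L a m : nat) : R :=
  poly_int01 ('X^(L * a) * (1 - 'X^L) ^+ m).

Lemma beta_int0 L a : beta_int L a 0 = (L * a)%N.+1%:R^-1.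
Proof. by rewrite /beta_int expr0 mulr1 poly_int01Xn. Qed.

Lemma beta_intS L a m : beta_int L a m.+1 = beta_int L a m - beta_int L a.+1 m.
Proof.
by rewrite /beta_int -linearB/= exprS mulnS exprD; congr poly_int01; ring.
Qed.

(** This is [(x + y) B(x + 1, y) = x B(x, y)] at [x = a + 1/L], [y = m + 1], with denominators
    cleared. The induction on [m] keeps [a] general because [beta_intS] raises it. *)
Lemma beta_int_shift L a m :
  beta_int L a.+1 m * (L * (a + m).+1).+1%:R = (L * a).+1%:R * beta_int L a m.
Proof.
elim: m a => [|m IH] a.
  by rewrite !beta_int0 addn0 mulVf ?mulfV// pnatr_eq0.
rewrite !beta_intS.
have := IH a; have := IH a.+1; rewrite !addSn !addnS !mulnS.
rewrite -![(_ + _).+1%:R]natr1 -![(_ * _).+1%:R]natr1 !natrD.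
move: (beta_int L a m) (beta_int L a.+1 m) (beta_int L a.+2 m) => x y z.
move=> e1 e2; apply/eqP; rewrite mulrBl e1 mulrBr -e2; apply/eqP; ring.
Qed.

End PolynomialIntegral.

(** * Bayes risk under the Beta(1/L, 1) prior and the resulting lower bound *)

Section BayesLowerBound.
Context {R : realType}.

Lemma beta_int_step L a m :
  beta_int L a m.+1 * (L * (a + m).+1).+1%:R =
  (L * m.+1)%:R * beta_int L a m :> R.
Proof.
rewrite beta_intS mulrBl beta_int_shift mulrC -mulrBl; congr (_ * _).
rewrite -natrB; first by congr _%:R; lia.
by rewrite ltnS leq_mul2l leqW ?leq_addr ?orbT.
Qed.

Lemma beta_int_gt0 L a m : (0 < L)%N -> 0 < beta_int L a m :> R.
Proof.
move=> L0; elim: m => [|m IH]; first by rewrite beta_int0 invr_gt0.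
rewrite -(@pmulr_lgt0 _ (L * (a + m).+1).+1%:R)// beta_int_step mulr_gt0//.
by rewrite ltr0n muln_gt0 L0.
Qed.

Lemma quadratic_ge (a b c x : R) : 0 < a ->
  c - b ^+ 2 / a <= a * x ^+ 2 - 2 * b * x + c.
Proof.
move=> a0; rewrite -subr_ge0.
have -> : a * x ^+ 2 - 2 * b * x + c - (c - b ^+ 2 / a) = (a * x - b) ^+ 2 / a.
  by field; rewrite gt_eqF.
by rewrite divr_ge0 ?sqr_ge0// ltW.
Qed.

(** The right-hand side is the minimum over [x] of the quadratic that the prior attaches to [k]
    failures and estimate [x]. Two uses of [beta_int_shift] make it an explicit multiple of
    [beta_int L d.+2 k]. *)
Lemma beta_int_posterior_risk L d k : (0 < L)%N ->
  beta_int L d.+2 k * (L%:R / (L * d.+1).+1%:R - (d + k).+1%:R^-1) <=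
  beta_int L d.+2 k - beta_int L d.+1 k ^+ 2 / beta_int L d k :> R.
Proof.
move=> L0.
have := beta_int_shift (R := R) L d k; have := beta_int_shift (R := R) L d.+1 k.
move: (beta_int_gt0 L d k L0) (beta_int_gt0 L d.+1 k L0).
move: (beta_int_gt0 L d.+2 k L0).
(* The numbering is reversed: [a0] has exponent index [d.+2] and [a2] has [d]. *)
move: (beta_int _ d k) (beta_int _ d.+1 k) (beta_int _ d.+2 k) => a2 a1 a0.
rewrite addSn -![(_ * _).+1%:R]natr1 !natrM -![_.+1%:R]natr1 natrD.
have : 0 < L%:R :> R by rewrite ltr0n.
have := ler0n R d; have := ler0n R k.
move: L%:R d%:R k%:R => l x y y0 x0 l0 a0_gt0 a2_gt0 a1_gt0 e0 e1.
have lx : 0 <= l * x by rewrite mulr_ge0// ltW.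
have ly : 0 <= l * y by rewrite mulr_ge0// ltW.
have n1 : 0 < l * (x + 1) + 1 by rewrite mulrDr mulr1; lra.
have n2 : 0 < l * (x + y + 1) + 1 by rewrite !mulrDr mulr1; lra.
have n3 : 0 < x + y + 1 by lra.
have n4 : 0 < l * (x + y + 1 + 1) + 1 by rewrite !mulrDr mulr1; lra.
have -> : a1 ^+ 2 / a2 = a0 * ((l * x + 1) / (l * (x + 1) + 1) *
    (1 + l / (l * (x + y + 1) + 1))).
  have -> : a2 = a1 * (l * (x + y + 1) + 1) / (l * x + 1).
    by rewrite e1; field; lra.
  have -> : a1 = a0 * (l * (x + y + 1 + 1) + 1) / (l * (x + 1) + 1).
    by rewrite e0; field; lra.
  by field; rewrite !gt_eqF//; lra.
set u := (l * x + 1) / _; set v := l / (l * (x + y + 1) + 1).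
have -> : l / (l * (x + 1) + 1) = 1 - u by rewrite /u; field; lra.
have -> : a0 - a0 * (u * (1 + v)) = a0 * (1 - u - u * v) by ring.
(* It remains that [u <= 1] and [v <= 1 / (x + y + 1)]. *)
rewrite ler_pM2l// lerD2l lerN2 -[leRHS]mul1r ler_pM ?divr_ge0//; try lra.
- by rewrite ler_pdivrMr//; lra.
- by rewrite ler_pdivrMr// ler_pdivlMl// mulrDr mulr1; lra.
Qed.

(* The mass that the Beta(1/L, 1) mixture gives to [k] failures. *)
Definition mixture_weight L d k : R :=
  'C(d.+1 + k, d.+1)%:R * beta_int L d.+2 k.

(* The mass of at least [k] failures. *)
Definition mixture_tail L d k : R :=
  (L * (d.+2 + k)).+1%:R * mixture_weight L d k.

Lemma mixture_tail0 L d : mixture_tail L d 0 = 1.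
Proof.
by rewrite /mixture_tail /mixture_weight !addn0 binn mul1r beta_int0 mulfV.
Qed.

Lemma mixture_tailS L d k :
  mixture_tail L d k.+1 = (L * (d.+2 + k))%:R * mixture_weight L d k.
Proof.
rewrite /mixture_tail /mixture_weight.
have := beta_int_step L d.+2 k; rewrite -addnS => e.
rewrite mulrCA [_ * beta_int L _ k.+1]mulrC e !mulrA; congr (_ * _).
have := mul_bin_down (d.+2 + k) d.+1; rewrite -[(_ + _).-1]/(d.+1 + k)%N => eb.
rewrite -!natrM -mulnA eb addnS -[(d.+1 + k).+1]/(d.+2 + k)%N.
have -> : (d.+2 + k - d.+1)%N = k.+1 by lia.
by rewrite mulnC -mulnA.
Qed.

Lemma mixture_tailB L d k :
  mixture_tail L d k - mixture_tail L d k.+1 = mixture_weight L d k.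
Proof. by rewrite mixture_tailS /mixture_tail -natr1; ring. Qed.

Lemma mixture_weight_gt0 L d k : (0 < L)%N -> 0 < mixture_weight L d k.
Proof.
by move=> L0; rewrite mulr_gt0 ?beta_int_gt0// ltr0n bin_gt0 leq_addr.
Qed.

Lemma mixture_tail_gt0 L d k : (0 < L)%N -> 0 < mixture_tail L d k.
Proof. by move=> L0; rewrite mulr_gt0// mixture_weight_gt0. Qed.

Lemma mixture_tail_le1 L d k : (0 < L)%N -> mixture_tail L d k <= 1.
Proof.
move=> L0; elim: k => [|k IH]; first by rewrite mixture_tail0.
by apply: le_trans IH; rewrite -subr_ge0 mixture_tailB ltW// mixture_weight_gt0.
Qed.

Lemma sum_mixture_weight L d K :
  \sum_(k < K) mixture_weight L d k = 1 - mixture_tail L d K.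
Proof.
elim: K => [|K IH]; first by rewrite big_ord0 mixture_tail0 subrr.
by rewrite big_ord_recr/= IH -mixture_tailB; ring.
Qed.

Lemma exprS_add1_ge (x : R) n : 0 <= x ->
  x ^+ n.+1 + n.+1%:R * x ^+ n <= (x + 1) ^+ n.+1.
Proof.
move=> x0; elim: n => [|n IH]; first by rewrite !expr1 expr0 mulr1.
rewrite [leRHS]exprS; apply: le_trans (ler_wpM2l _ IH); last first.
  by rewrite addr_ge0.
have xn : 0 <= n.+1%:R * x ^+ n by rewrite mulr_ge0// exprn_ge0.
rewrite -(natr1 n.+1) !exprS in xn *; nra.
Qed.

(** With [n = d + 2 + k], consecutive tails have ratio [L n / (L n + 1)], whose [L]-th power is at
    most [n / (n + 1)] by [exprS_add1_ge]. So the left-hand side does not increase with [k], and for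
    fixed [L] the tail tends to 0. *)
Lemma mixture_tail_exp L d k : (0 < L)%N ->
  mixture_tail L d k ^+ L * (d.+2 + k)%:R <= d.+2%:R.
Proof.
move=> L0; elim: k => [|k IH].
  by rewrite mixture_tail0 expr1n mul1r addn0.
apply: le_trans IH; rewrite mixture_tailS /mixture_tail.
have := mixture_weight_gt0 L d k L0; move: (mixture_weight L d k) => w w0.
rewrite !exprMn ![_ * w ^+ _]mulrC -!mulrA ler_pM2l ?exprn_gt0//.
rewrite addnS; move: (d.+2 + k)%N => n.
rewrite -[n.+1%:R]natr1 -[(L * n).+1%:R]natr1.
case: L L0 => // m _.
have := exprS_add1_ge (m.+1 * n)%:R m (ler0n _ _).
move=> /(ler_wpM2r (ler0n R n)); apply: le_trans.
rewrite le_eqVlt; apply/orP; left; apply/eqP.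
by rewrite exprS; move: (_ ^+ m) => z; rewrite natrM; ring.
Qed.

(** Controls the error term of [beta_int_posterior_risk]. As the tail is at most 1, the weight is at
    most [1 / (L (d + k + 2))], and the resulting bound telescopes. *)
Lemma sum_mixture_weight_div_le L d K : (0 < L)%N ->
  \sum_(k < K) mixture_weight L d k / (d + k).+1%:R <= L%:R^-1.
Proof.
move=> L0.
apply: (@le_trans _ _ (L%:R^-1 * (d.+1%:R^-1 - (d.+1 + K)%:R^-1))); last first.
  rewrite -[leRHS]mulr1 ler_pM2l ?invr_gt0 ?ltr0n//.
  by rewrite (@le_trans _ _ d.+1%:R^-1)// ?gerBl ?invr_ge0// invf_le1// ler1n.
elim: K => [|K IH]; first by rewrite big_ord0 addn0 subrr mulr0.
rewrite big_ord_recr/=; apply: le_trans (lerD IH (lexx _)) _.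
rewrite -lerBrDl -mulrBr addnS addSn.
have n0 : 0 < (d + K).+1%:R :> R by rewrite ltr0n.
have n1 : 0 < (d + K).+2%:R :> R by rewrite ltr0n.
have l0 : 0 < L%:R :> R by rewrite ltr0n.
have -> : d.+1%:R^-1 - (d + K).+2%:R^-1 - (d.+1%:R^-1 - (d + K).+1%:R^-1) =
    (d + K).+2%:R^-1 / (d + K).+1%:R :> R.
  rewrite -[(d + K).+2%:R]natr1; field.
  by rewrite ?natr1 ?nat1r ?pnatr_eq0 ?gt_eqF.
rewrite mulrA ler_pM2r ?invr_gt0// -invfM -[leRHS]mul1r ler_pdivlMr ?mulr_gt0//.
apply: le_trans (mixture_tail_le1 L d K L0); rewrite /mixture_tail [leRHS]mulrC.
by rewrite ler_pM2l ?mixture_weight_gt0// -natrM ler_nat !addSn leqW.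
Qed.

(* The hypothesis bounds the partial sums of the risk at [p] of the
   estimator [g (N - r)], where [r = d + 2]. *)
Lemma risk_mixture_le d (g : nat -> R) (C : R) L K : (0 < L)%N ->
  (forall p : R, 0 < p < 1 -> \sum_(k < K)
    'C(d.+1 + k, d.+1)%:R * (p ^+ d * (1 - p) ^+ k * (g k - p) ^+ 2) <= C) ->
  L%:R / (L * d.+1).+1%:R - L%:R^-1 - mixture_tail L d K <= C.
Proof.
move=> L0 riskC.
(* The partial risk at [p = q ^ L] as a polynomial in [q], with each square expanded so that its
   integral is a quadratic in [g k] with [beta_int] coefficients. *)
pose f : {poly R} := \sum_(k < K) 'C(d.+1 + k, d.+1)%:R *:
  (g k ^+ 2 *: ('X^(L * d) * (1 - 'X^L) ^+ k) -
   (2 * g k) *: ('X^(L * d.+1) * (1 - 'X^L) ^+ k) +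
   'X^(L * d.+2) * (1 - 'X^L) ^+ k).
have fC : poly_int01 f <= C.
  apply: poly_int01_le => q /andP[q0 q1].
  apply: le_trans (riskC (q ^+ L) _); last first.
    by rewrite exprn_gt0// exprn_ilt1 ?ltW ?gtn_eqF.
  rewrite horner_sum le_eqVlt; apply/orP; left; apply/eqP/eq_bigr => k _.
  rewrite !hornerE /= !mulnS !exprD !exprM; ring.
apply: le_trans fC.
rewrite /f linear_sum/=.
apply: (@le_trans _ _ (\sum_(k < K) mixture_weight L d k *
    (L%:R / (L * d.+1).+1%:R - (d + k).+1%:R^-1))); last first.
  apply: ler_sum => k _.
  rewrite linearZ linearD linearB !linearZ/= -!/(beta_int L _ _).
  rewrite -mulrA ler_pM2l ?ltr0n ?bin_gt0 ?leq_addr//.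
  apply: le_trans (beta_int_posterior_risk L d k L0) _.
  have := quadratic_ge _ (beta_int L d.+1 k) (beta_int L d.+2 k) (g k)
    (beta_int_gt0 L d k L0).
  by rewrite /GRing.scale/=; congr (_ <= _); ring.
under eq_bigr do rewrite mulrBr.
(* The factor [L / (L (d + 1) + 1)] is at most 1, so truncating at [K] costs at most
   [mixture_tail L d K]. *)
rewrite sumrB -mulr_suml sum_mixture_weight.
have := sum_mixture_weight_div_le L d K L0.
have : 0 <= L%:R / (L * d.+1).+1%:R :> R by rewrite divr_ge0.
have : L%:R / (L * d.+1).+1%:R <= 1 :> R.
  by rewrite ler_pdivrMr// mul1r ler_nat leqW// leq_pmulr.
have := mixture_tail_gt0 L d K L0.
move: (mixture_tail _ _ _) (_ / (L * _).+1%:R) (\sum_(k < K) _) L%:R^-1.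
by move=> t x y z t0 x1 x0 yz; nra.
Qed.

Lemma risk_lower_bound d (g : nat -> R) (C : R) :
  (forall K (p : R), 0 < p < 1 -> \sum_(k < K)
    'C(d.+1 + k, d.+1)%:R * (p ^+ d * (1 - p) ^+ k * (g k - p) ^+ 2) <= C) ->
  d.+1%:R^-1 <= C.
Proof.
move=> riskC.
have le_L L : (0 < L)%N -> L%:R / (L * d.+1).+1%:R - L%:R^-1 <= C.
  move=> L0; rewrite leNgt -subr_gt0; apply/negP; set e := (X in 0 < X) => e0.
  (* A positive gap [e] would bound all the tails from below, against [mixture_tail_exp] once [K]
     exceeds [(d + 2) / e ^ L]. *)
  have tail_ge K : e <= mixture_tail L d K.
    by have := risk_mixture_le d g C L K L0 (riskC K); rewrite lerBlDr -lerBlDl.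
  have := archi_boundP (divr_ge0 (ler0n R d.+2) (exprn_ge0 L (ltW e0))).
  move: (Num.bound _) => K; rewrite ltr_pdivrMr ?exprn_gt0//; apply/negP.
  rewrite -leNgt; apply: le_trans (mixture_tail_exp L d K L0).
  rewrite mulrC ler_pM ?exprn_ge0 ?ler_nat ?leq_addl ?(ltW e0)//.
  by rewrite lerXn2r ?nnegrE ?(ltW e0)// ltW// mixture_tail_gt0.
rewrite leNgt -subr_gt0; apply/negP; set e := (X in 0 < X) => e0.
(* [L > 2 / e] suffices: the bound [le_L] falls short of [1 / (d + 1)] by less than [2 / L], one
   [1 / L] being explicit and the other bounding [1 / (x (l x + 1))]. *)
have := archi_boundP (divr_ge0 (ler0n R 2) (ltW e0)); move: (Num.bound _) => L.
rewrite ltr_pdivrMr// => eL.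
have L0 : (0 < L)%N.
  by rewrite lt0n; apply: contraTneq eL => ->; rewrite mul0r -leNgt.
have l0 : 0 < L%:R :> R by rewrite ltr0n.
have := le_L L L0; apply/negP; rewrite -ltNge.
have d0 : 0 < d.+1%:R :> R by [].
have d1 : 1 <= d.+1%:R :> R by rewrite ler1n.
rewrite -[(L * _).+1%:R]natr1 natrM.
move: d0 d1 l0 eL; rewrite /e; move: d.+1%:R L%:R => x l x0 x1 l0 eL.
have lx0 : 0 < l * x + 1 by rewrite addr_gt0// mulr_gt0.
have -> : l / (l * x + 1) = x^-1 - (x * (l * x + 1))^-1.
  by field; rewrite !gt_eqF.
have : (x * (l * x + 1))^-1 < l^-1.
  rewrite ltf_pV2 ?posrE ?mulr_gt0//.
  have : l <= l * x by rewrite ler_peMr// ltW.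
  by nra.
have : 2 * l^-1 < x^-1 - C by rewrite ltr_pdivrMr// [ltRHS]mulrC.
by lra.
Qed.

End BayesLowerBound.

(** * Negative binomial laws and the upper bound on the risk *)

Section NegativeBinomial.
Context {R : realType}.
Implicit Type p : R.

(** The law of the number [k] of failures before success number [s.+1]; this offset avoids
    predecessors. *)
Definition neg_binomial_pmf (s : nat) p (k : nat) : R :=
  'C(s + k, s)%:R * p ^+ s.+1 * (1 - p) ^+ k.

Definition neg_binomial_cdf (s : nat) p (K : nat) : R :=
  \sum_(k < K) neg_binomial_pmf s p k.

Lemma neg_binomial_pmf_ge0 s p k : 0 < p < 1 -> 0 <= neg_binomial_pmf s p k.
Proof.
by move=> /andP[p0 p1]; rewrite !mulr_ge0 ?exprn_ge0 ?subr_ge0// ltW.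
Qed.

Lemma neg_binomial_cdf0 p K : neg_binomial_cdf 0 p K = 1 - (1 - p) ^+ K.
Proof.
elim: K => [|K IH]; first by rewrite /neg_binomial_cdf big_ord0 subrr.
by rewrite /neg_binomial_cdf big_ord_recr/= -/(neg_binomial_cdf 0 p K) IH
  /neg_binomial_pmf bin0 expr1 exprS; ring.
Qed.

(* Conditioning on the outcome of the first trial. *)
Lemma neg_binomial_cdfS s p K :
  neg_binomial_cdf s.+1 p K.+1 =
  (1 - p) * neg_binomial_cdf s.+1 p K + p * neg_binomial_cdf s p K.+1.
Proof.
rewrite /neg_binomial_cdf big_ord_recl [in X in p * X]big_ord_recl/=.
rewrite mulrDr addrCA; congr (_ + _).
  by rewrite /neg_binomial_pmf !addn0 !binn [p ^+ s.+2]exprS; ring.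
rewrite !mulr_sumr -big_split/=; apply: eq_bigr => k _.
by rewrite /neg_binomial_pmf /bump/= add1n addSn !addnS binS natrD !exprS; ring.
Qed.

Lemma neg_binomial_cdf_nondecreasing s p : 0 < p < 1 ->
  nondecreasing_seq (neg_binomial_cdf s p).
Proof.
move=> p01; apply/nondecreasing_seqP => K.
by rewrite /neg_binomial_cdf big_ord_recr/= lerDl neg_binomial_pmf_ge0.
Qed.

Lemma neg_binomial_cdf_le1 s p K : 0 < p < 1 -> neg_binomial_cdf s p K <= 1.
Proof.
move=> p01; have /andP[p0 p1] := p01; elim: s K => [|s IHs].
  by move=> K; rewrite neg_binomial_cdf0 gerBl exprn_ge0// subr_ge0 ltW.
elim=> [|K IHK]; first by rewrite /neg_binomial_cdf big_ord0.
by rewrite neg_binomial_cdfS; have := IHs K.+1; nra.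
Qed.

(** By induction on [s]: the limit [l] exists by monotonicity and boundedness, and
    [neg_binomial_cdfS] gives [l = (1 - p) l + p], so [l = 1]. *)
Lemma cvg_neg_binomial_cdf s p :
  0 < p < 1 -> neg_binomial_cdf s p @ \oo --> (1 : R).
Proof.
move=> p01; have /andP[p0 p1] := p01; elim: s => [|s IHs].
  have -> : neg_binomial_cdf 0 p = fun K => 1 - (1 - p) ^+ K.
    by apply/funext => K; exact: neg_binomial_cdf0.
  rewrite -[1 in X in _ --> X]subr0; apply: cvgB; first exact: cvg_cst.
  by apply: cvg_expr; rewrite ger0_norm; lra.
have /cvg_ex[l cl] : cvgn (neg_binomial_cdf s.+1 p).
  apply: nondecreasing_is_cvgn; first exact: neg_binomial_cdf_nondecreasing.
  by exists 1 => _ [K _ <-]; exact: neg_binomial_cdf_le1.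
suff e : l = (1 - p) * l + p * 1.
  by have -> : 1 = l by apply: (mulfI (lt0r_neq0 p0)); lra.
have /cvg_lim <- // : neg_binomial_cdf s.+1 p @ \oo --> (1 - p) * l + p * 1.
  rewrite -cvg_shiftS.
  have -> : [sequence neg_binomial_cdf s.+1 p K.+1]_K = fun K =>
      (1 - p) * neg_binomial_cdf s.+1 p K + p * neg_binomial_cdf s p K.+1.
    by apply/funext => K; exact: neg_binomial_cdfS.
  apply: cvgD; first exact: cvgMl_tmp cl.
  by apply: cvgMl_tmp; move: IHs; rewrite -cvg_shiftS.
by apply/esym/cvg_lim.
Qed.

(* The right-hand side comes from [1 / (n - 1) ^ 2 <= 1 / ((n - 1) (n - 2))]
   with [n = d + 3 + k], [(n - 1) p] and [(n - 2) p] being absorbed by the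
   binomial coefficient. *)
Lemma mse_term_le d p k : 0 < p < 1 ->
  neg_binomial_pmf d.+2 p k * (d.+1%:R / (d.+2 + k)%:R / p - 1) ^+ 2 <=
  d.+1%:R / d.+2%:R * (neg_binomial_pmf d p k - 2 * neg_binomial_pmf d.+1 p k)
  + neg_binomial_pmf d.+2 p k.
Proof.
move=> /andP[p0 p1].
have e1 : (d.+2 + k)%:R * 'C(d.+1 + k, d.+1)%:R =
    d.+2%:R * 'C(d.+2 + k, d.+2)%:R :> R.
  by rewrite -!natrM -mul_bin_diag.
have e2 : (d.+1 + k)%:R * 'C(d + k, d)%:R =
    d.+1%:R * 'C(d.+1 + k, d.+1)%:R :> R.
  by rewrite -!natrM -mul_bin_diag.
rewrite /neg_binomial_pmf [p ^+ d.+3]exprS [p ^+ d.+2]exprS.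
have : 0 <= (1 - p) ^+ k by rewrite exprn_ge0// subr_ge0 ltW.
have : 0 < p ^+ d.+1 by rewrite exprn_gt0.
have : 0 < d.+1%:R :> R by []. have : 0 < (d.+1 + k)%:R :> R by [].
have : 0 <= 'C(d.+2 + k, d.+2)%:R :> R by [].
move: e1 e2; rewrite -[(d.+2 + k)%:R]natr1 -[d.+2%:R]natr1.
rewrite -[(d.+1 + k)%N]/(d + k).+1.
move: 'C(_, d.+2)%:R 'C(_, d.+1)%:R 'C(_, d)%:R d.+1%:R (d + k).+1%:R.
move=> c b a x n.
move: (p ^+ _) ((1 - p) ^+ _) => P Q e1 e2 c0 n0 x0 P0 Q0.
have -> : a = x * b / n by rewrite -e2 mulrAC mulfV ?mul1r// gt_eqF.
have -> : b = (x + 1) * c / (n + 1) by rewrite -e1 mulrAC mulfV ?mul1r//; lra.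
(* The gap is exactly the one between [1 / (n (n + 1))] and [1 / (n + 1) ^ 2]. *)
rewrite -subr_ge0 (_ : _ - _ = c * P * Q * x ^+ 2 / (n * (n + 1) ^+ 2)).
  by rewrite divr_ge0 ?mulr_ge0 ?exprn_ge0//; lra.
by field; rewrite !gt_eqF//; lra.
Qed.

Lemma mse_partial_sum_le d p K : 0 < p < 1 ->
  \sum_(k < K) neg_binomial_pmf d.+2 p k *
    (d.+1%:R / (d.+2 + k)%:R / p - 1) ^+ 2 <= d.+2%:R^-1.
Proof.
move=> p01; pose F k := neg_binomial_pmf d.+2 p k *
  (d.+1%:R / (d.+2 + k)%:R / p - 1) ^+ 2.
pose c : R := d.+1%:R / d.+2%:R.
(* [T] contains a subtraction, so its limit is used: the partial sum up to [K] is below [T M] for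
   every [M >= K]. *)
pose T M := c * (neg_binomial_cdf d p M - 2 * neg_binomial_cdf d.+1 p M) +
  neg_binomial_cdf d.+2 p M.
have FT M : \sum_(k < M) F k <= T M.
  rewrite /T /neg_binomial_cdf !mulr_sumr -sumrB mulr_sumr -big_split/=.
  by apply: ler_sum => k _; exact: mse_term_le.
have T_cvg : T @ \oo --> c * (1 - 2 * 1) + 1.
  apply: cvgD; last exact: cvg_neg_binomial_cdf.
  apply: cvgMl_tmp; apply: cvgB; first exact: cvg_neg_binomial_cdf.
  by apply: cvgMl_tmp; exact: cvg_neg_binomial_cdf.
have <- : c * (1 - 2 * 1) + 1 = d.+2%:R^-1.
  rewrite /c -[d.+2%:R]natr1; have : 0 < d.+1%:R :> R by [].
  by move: d.+1%:R => x x0; field; lra.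
move/cvg_lim : (T_cvg) => <- //.
apply: limr_ge; first by apply/cvg_ex; eexists; exact: T_cvg.
near=> M; apply: le_trans (FT M).
have KM : (K <= M)%N by near: M; exact: nbhs_infty_ge.
rewrite -!(big_mkord xpredT F) (big_cat_nat (leq0n K) KM)//=.
rewrite lerDl sumr_ge0// => k _.
by rewrite mulr_ge0 ?sqr_ge0// neg_binomial_pmf_ge0.
Unshelve. all: by end_near. Qed.

End NegativeBinomial.

(** * Integrals against distribution functions: point masses and Jensen's inequality *)

Section StieltjesMoments.
Context {R : realType}.
Local Open Scope measure_display_scope.

Let nonneg : set (measurableTypeR R) := `[0, +oo[%classic.

Let measurable_nonneg : measurable nonneg.
Proof. exact: measurable_itv. Qed.

(** Both measures agree on the half-open intervals []x, y]], which determine a Lebesgue-Stieltjes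
    measure. *)
Lemma lebesgue_stieltjes_step_cdf (a : R) (A : set (measurableTypeR R)) :
  measurable A ->
  lebesgue_stieltjes_measure (step_cdf a) A = \d_(a : measurableTypeR R) A.
Proof.
move=> mA; apply: lebesgue_stieltjes_measure_unique => // _ [[x y] _ <-]/=.
rewrite /lebesgue_stieltjes_measure /measure_extension/=.
rewrite measurable_mu_extE/=; last exact: is_ocitv.
have [xy|yx] := leP x y; last first.
  by rewrite set_itv_ge ?wlength0 ?measure0// bnd_simp -leNgt ltW.
rewrite wlength_itv_bnd// /step_cdf diracE mem_setE in_itv/=.
have [xa|ax] := ltP x a; rewrite ?andbF/=; last first.
  by rewrite (le_trans ax xy) subrr.
by rewrite subr0.
Qed.

Lemma integral_step_cdf (a : R) (f : measurableTypeR R -> \bar R) : 0 < a ->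
  measurable_fun nonneg f ->
  (\int[lebesgue_stieltjes_measure (step_cdf a)]_(y in nonneg) f y = f a)%E.
Proof.
move=> a0 mf; rewrite (eq_measure_integral \d_(a : measurableTypeR R)); last first.
  by move=> A mA _; exact: lebesgue_stieltjes_step_cdf.
rewrite integral_dirac// diracE mem_set ?mul1e//.
by rewrite /nonneg/= in_itv/= andbT ltW.
Qed.

Lemma lebesgue_stieltjes_nonneg (F : cumulativeBounded (0 : R) (1 : R)) :
  F 0 = 0 -> lebesgue_stieltjes_measure F nonneg = 1%E.
Proof.
move=> F0.
have mneg : measurable (`]-oo, 0[%classic : set (measurableTypeR R)).
  exact: measurable_itv.
have neg0 : lebesgue_stieltjes_measure F `]-oo, 0[%classic = 0%E.
  apply/eqP; rewrite eq_le measure_ge0 andbT.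
  have := cdf_lebesgue_stieltjes_id F 0.
  rewrite F0 /cdf /distribution /pushforward preimage_id => e.
  rewrite -[leRHS]e; apply: le_measure; rewrite ?inE//.
  by move=> y; rewrite /= !in_itv/=; exact: ltW.
have -> : nonneg = ~` `]-oo, 0[%classic by rewrite setCitvl.
by rewrite [LHS](probability_setC _ mneg) [X in (1 - X)%E]neg0 sube0.
Qed.

Let sqr_err (p : R) (y : measurableTypeR R) : R := (y / p - 1) ^+ 2.

(** Taken at [u = y / p0], it makes the mean finite as soon as the risk at one [p0] is finite. *)
Let norm_le_sqr_err (u : R) : `|u| <= (u - 1) ^+ 2 + 2.
Proof.
have := sqr_ge0 (2 * u - 3); have := sqr_ge0 (2 * u - 1).
by rewrite ler_norml !expr2; lra.
Qed.

Let measurable_sqr_err p :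
  measurable_fun nonneg (sqr_err p).
Proof.
apply: measurable_funS measurableT _ _ => //.
apply: measurable_funX; apply: measurable_funB => //.
exact: measurable_funM.
Qed.

Let integrable_sqr_err (F : cumulativeBounded (0 : R) (1 : R)) p :
  (\int[lebesgue_stieltjes_measure F]_(y in nonneg) (sqr_err p y)%:E < +oo)%E ->
  (lebesgue_stieltjes_measure F).-integrable nonneg (EFin \o sqr_err p).
Proof.
move=> fin; apply/integrableP; split.
  by apply/measurable_EFinP; exact: measurable_sqr_err.
under eq_integral do rewrite /= ger0_norm ?sqr_ge0//.
by [].
Qed.

(* By Jensen; [g] is the mean of [F], or any number if the second moment of [F]
   is infinite. *)
Lemma conditional_mean_le (F : cumulativeBounded (0 : R) (1 : R)) : F 0 = 0 ->
  exists g : R, forall p, 0 < p ->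
    (((g / p - 1) ^+ 2)%:E <=
     \int[lebesgue_stieltjes_measure F]_(y in `[0%R, +oo[)
       ((y / p - 1) ^+ 2)%:E)%E.
Proof.
move=> F0; pose mu := lebesgue_stieltjes_measure F.
have [[p0 p0_gt0 fin0]|inf] := pselect (exists2 p, 0 < p &
    (\int[mu]_(y in nonneg) (sqr_err p y)%:E < +oo)%E); last first.
  (* The integral is infinite for every positive [p], so 0 is an arbitrary choice. *)
  exists 0 => p p_gt0; rewrite (_ : (\int[_]_(y in _) _)%E = +oo%E) ?leey//.
  apply/eqP; apply: contra_notT inf => fin; exists p => //.
  by rewrite ltey.
have cst_int (c : R) : mu.-integrable nonneg (EFin \o cst c).
  exact: finite_measure_integrable_cst.
have id_int : mu.-integrable nonneg (EFin \o (fun y : R => y)).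
  have /= h := integrableZl measurable_nonneg p0
    (integrableD measurable_nonneg (integrable_sqr_err _ _ fin0) (cst_int 2)).
  apply: le_integrable h => //.
    by apply/measurable_EFinP; exact: measurable_funS measurableT _ _.
  move=> y _ /=; rewrite lee_fin [leRHS]ger0_norm; last first.
    by rewrite mulr_ge0 ?addr_ge0 ?sqr_ge0// ltW.
  have -> : `|y| = p0 * `|y / p0|.
    by rewrite normrM normfV (gtr0_norm p0_gt0) mulrC divfK ?gt_eqF.
  rewrite ler_pM2l//; apply: norm_le_sqr_err.
exists (\int[mu]_(y in nonneg) y)%R => p p_gt0; set g := Rintegral _ _ _.
have [fin|] := ltP (\int[mu]_(y in nonneg) (sqr_err p y)%:E)%E +oo%E; last first.
  by rewrite leye_eq => /eqP ->; rewrite leey.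
have err_int := integrable_sqr_err _ _ fin.
pose c := g / p - 1.
have lin_int : mu.-integrable nonneg (EFin \o (fun y : R => 2 * c / p * y)).
  exact: (integrableZl measurable_nonneg (2 * c / p) id_int).
(* The integrand on the left is the tangent to the squared error at the mean [g]; the difference is
   a square, and the integral of the tangent is [c ^ 2]. *)
have tangent : \int[mu]_(y in nonneg) (2 * c / p * y + (- 2 * c - c ^+ 2)) <=
    \int[mu]_(y in nonneg) sqr_err p y.
  apply: le_Rintegral => //.
    exact: (integrableD measurable_nonneg lin_int (cst_int _)).
  move=> y _; rewrite /sqr_err -subr_ge0.
  rewrite (_ : _ - _ = (y / p - 1 - c) ^+ 2) ?sqr_ge0//.
  by field; rewrite gt_eqF.
have mean_lin : \int[mu]_(y in nonneg) (2 * c / p * y + (- 2 * c - c ^+ 2)) =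
    2 * c / p * g + (- 2 * c - c ^+ 2).
  apply: etrans (RintegralD measurable_nonneg lin_int (cst_int _)) _.
  congr (_ + _); first exact: RintegralZl measurable_nonneg id_int.
  apply: etrans (Rintegral_cst _ measurable_nonneg _) _.
  by rewrite [X in fine X](lebesgue_stieltjes_nonneg _ F0) mulr1.
rewrite mean_lin in tangent.
rewrite -[leRHS]fineK; last first.
  exact: (integrable_fin_num measurable_nonneg err_int).
rewrite lee_fin; apply: le_trans tangent.
rewrite le_eqVlt; apply/orP; left; apply/eqP; rewrite /c; field.
by rewrite gt_eqF.
Qed.

End StieltjesMoments.

(** * The two bounds for the risk of estimators *)

Section Risk.
Context {R : realType}.

Lemma inv_binomial_pmf_shift (r : nat) (p : R) k :
  inv_binomial_pmf r.+1 p (r.+1 + k) = neg_binomial_pmf r p k.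
Proof. by rewrite /inv_binomial_pmf /neg_binomial_pmf addKn. Qed.

Lemma sum_nat_shift (V : nmodType) r K (F : nat -> V) :
  \sum_(r <= n < r + K) F n = \sum_(k < K) F (r + k)%N.
Proof.
rewrite -{1}(add0n r) big_addn addKn big_mkord.
by apply: eq_bigr => k _; rewrite addnC.
Qed.

Lemma inv_binomial_pmf_ge0 r (p : R) n :
  0 < p < 1 -> 0 <= inv_binomial_pmf r p n.
Proof.
by move=> /andP[p0 p1]; rewrite !mulr_ge0 ?exprn_ge0 ?subr_ge0// ltW.
Qed.

Lemma normalized_mse_term_ge0 r
    (Pi : nat -> cumulativeBounded (0 : R) (1 : R)) p n :
  0 < p < 1 -> (0 <= (inv_binomial_pmf r p n)%:E *
     \int[lebesgue_stieltjes_measure (Pi n)]_(y in `[0%R, +oo[)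
       ((y / p - 1) ^+ 2)%:E)%E.
Proof.
move=> p01; rewrite mule_ge0 ?lee_fin ?inv_binomial_pmf_ge0//.
by apply: integral_ge0 => y _; rewrite lee_fin sqr_ge0.
Qed.

Lemma normalized_mse_opt_le d (p : R) : 0 < p < 1 ->
  (normalized_mse d.+3
     (nonrandomized (fun n : nat => ((d.+3%:R - 2) / (n%:R - 1))%R)) p <=
   d.+2%:R^-1%:E)%E.
Proof.
move=> p01; apply: lime_le.
  by apply: is_cvg_nneseries => n _ _; exact: normalized_mse_term_ge0.
apply: nearW => M; have [Md|/ltnW dM] := leqP M d.+3.
  by rewrite big_geq// lee_fin.
rewrite -(subnKC dM) sum_nat_shift.
have := mse_partial_sum_le d p (M - d.+3) p01.
rewrite -lee_fin; apply: le_trans.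
rewrite -sumEFin le_eqVlt; apply/orP; left; apply/eqP/eq_bigr => k _.
rewrite /nonrandomized.
have -> : (d.+3%:R - 2) / ((d.+3 + k)%:R - 1) = d.+1%:R / (d.+2 + k)%:R :> R.
  by rewrite -natrB// addSn -natr1 addrK.
rewrite inv_binomial_pmf_shift integral_step_cdf ?EFinM ?divr_gt0//.
apply/measurable_EFinP; apply: measurable_funS measurableT _ _ => //.
apply: measurable_funX; apply: measurable_funB => //.
exact: measurable_funM.
Qed.

Lemma sup_normalized_mse_ge d (Pi : nat -> cumulativeBounded (0 : R) (1 : R)) :
  estimator_family d.+3 Pi -> (d.+2%:R^-1%:E <= sup_normalized_mse d.+3 Pi)%E.
Proof.
move=> estPi; have le_sup p : 0 < p < 1 ->
    (normalized_mse d.+3 Pi p <= sup_normalized_mse d.+3 Pi)%E.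
  by move=> p01; apply: ereal_sup_ubound; exists p => //=; rewrite in_itv.
have sup_ge0 : (0 <= sup_normalized_mse d.+3 Pi)%E.
  have h01 : 0 < (2^-1 : R) < 1 by lra.
  apply: le_trans (le_sup _ h01); apply: nneseries_ge0 => n _ _.
  exact: normalized_mse_term_ge0.
case: (sup_normalized_mse d.+3 Pi) le_sup sup_ge0 => [C| |] le_sup; last 2 first.
- by move=> _; rewrite leey.
- by rewrite leNgt ltNyr.
move=> _; rewrite lee_fin.
have /choice[g g_le] : forall k, exists g : R, forall p, 0 < p ->
    (((g / p - 1) ^+ 2)%:E <=
     \int[lebesgue_stieltjes_measure (Pi (d.+3 + k)%N)]_(y in `[0%R, +oo[)
       ((y / p - 1) ^+ 2)%:E)%E.
  by move=> k; apply/conditional_mean_le/estPi; rewrite leq_addr.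
(* Here [r = d + 3], whereas [risk_lower_bound] has [r = d + 2], hence [d.+1]. Two factors of
   [p ^ r] turn [(g k / p - 1) ^ 2] into [(g k - p) ^ 2]. *)
apply: (risk_lower_bound d.+1 g) => K p p01; rewrite -lee_fin.
apply: le_trans (le_sup p p01).
apply: le_trans (nneseries_lim_ge (d.+3 + K) _); last first.
  by move=> n _ _; exact: normalized_mse_term_ge0.
rewrite sum_nat_shift -sumEFin; apply: lee_sum => k _.
have /andP[p0 _] := p01.
apply: (@le_trans _ _ ((inv_binomial_pmf d.+3 p (d.+3 + k))%:E *
    ((g k / p - 1) ^+ 2)%:E)%E); last first.
  by rewrite lee_wpmul2l ?lee_fin ?inv_binomial_pmf_ge0// g_le.
rewrite inv_binomial_pmf_shift -EFinM lee_fin.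
rewrite le_eqVlt; apply/orP; left; apply/eqP.
rewrite /neg_binomial_pmf [p ^+ d.+3]exprSr [p ^+ d.+2]exprSr.
by field; rewrite gt_eqF.
Qed.

End Risk.

Theorem corollary3 (R : realType) (r : nat) (r3 : (3 <= r)%N) :
  let opt : nat -> cumulativeBounded (0 : R) (1 : R) :=
    nonrandomized (fun n : nat => (r%:R - 2) / (n%:R - 1)) in
  estimator_family r opt /\
  forall Pi : nat -> cumulativeBounded (0 : R) (1 : R),
    estimator_family r Pi ->
    (sup_normalized_mse r opt <= sup_normalized_mse r Pi)%E.
Proof.
case: r r3 => [//|[//|[//|d _]]] opt; split.
  move=> n rn; rewrite /opt /nonrandomized/= /step_cdf leNgt divr_gt0//.
  by rewrite subr_gt0 ltr1n (leq_trans _ rn).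
move=> Pi /sup_normalized_mse_ge; apply: le_trans; apply: ge_ereal_sup.
by move=> _ [p p01 <-]; apply: normalized_mse_opt_le; rewrite /= in_itv in p01.
Qed.
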